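(* Let $A\in\mathbb{R}^{n\times n}$, $B_1\in\mathbb{R}^{n\times d}$, $B_2\in\mathbb{R}^{n\times e}$, $C_1\in\mathbb{R}^{q\times n}$, $F_1\in\mathbb{R}^{q\times e}$, $C_2\in\mathbb{R}^{p\times n}$, $F_2\in\mathbb{R}^{p\times e}$, let $f(t,\cdot):\mathbb{R}^q\to\mathbb{R}^d$ for $t\in\mathbb{N}$, and consider the discrete-time Lur'e system $$x_{t+1}=Ax_t+B_1z_t+B_2w_t,\qquad z_t=f(t,\,C_1x_t+F_1w_t),\qquad y_t=C_2x_t+F_2w_t,\qquad t\in\mathbb{N},$$ with state $x_t\in\mathbb{R}^n$, external input $w_t\in\mathbb{R}^e$ and output $y_t\in\mathbb{R}^p$. Assume: (A1) $\Delta\in\mathbb{R}^{d\times q}_{\ge 0}$ is a matrix such that for all $\zeta_1,\zeta_2\in\mathbb{R}^q$, $\sup_{t\in\mathbb{N}}|f(t,\zeta_1)-f(t,\zeta_2)|\le \Delta|\zeta_1-\zeta_2|$ (elementwise); (A2) the matrices $B_1,B_2,F_1,F_2$ are elementwise nonnegative; (A3) the matrices $A,C_1,C_2$ are elementwise nonnegative. Put $A_\Delta:=A+B_1\Delta C_1$ and $B_\Delta:=B_2+B_1\Delta F_1$, and let $\eta\in\mathbb{R}$. If there exists $v\in\mathbb{R}^n_{>0}$ such that $$v-A_\Delta v-B_\Delta\mathbf{1}_e\in\mathbb{R}^n_{>0},\qquad \eta\mathbf{1}_p-F_2\mathbf{1}_e-C_2v\in\mathbb{R}^p_{>0},$$ then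 the incremental $\ell_\infty$ gain $w\to y$ of the system is upper-bounded by $\eta$.
   Context: $\mathbb{N}$ includes $0$. $\mathbb{R}^n_{>0}$ (resp. $\mathbb{R}^n_{\ge0}$) is the set of vectors with all entries positive (resp. nonnegative), and similarly for matrices. $\mathbf{1}_n$ is the all-ones vector in $\mathbb{R}^n$. $|x|$ is the elementwise absolute value of a vector or matrix, and inequalities between vectors are elementwise (the supremum over $t$ in (A1) is also elementwise). For a sequence $y=\{y_t\}_{t\in\mathbb{N}}$ of vectors, $\|y\|_\infty=\sup_{t\in\mathbb{N}}\|y_t\|_\infty$, where $\|y_t\|_\infty$ is the maximum absolute entry of $y_t$. The incremental $\ell_\infty$ gain $w\to y$ of the system is $$\sup_{w^1,w^2}\frac{\|y^1-y^2\|_\infty}{\|w^1-w^2\|_\infty},$$ where the supremum is over all input-output pairs $(w^1,y^1),(w^2,y^2)$ of the system generated from the same initial condition $x_0$ (for any such $x_0$), with $0<\|w^1-w^2\|_\infty<\infty$ so that the ratio is meaningful. *)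

(* Defs.v *)
From mathcomp Require Import all_boot all_order all_algebra.
From mathcomp Require Import all_classical all_reals all_analysis.
Set Implicit Arguments.
Unset Strict Implicit.
Unset Printing Implicit Defensive.
Import Order.TTheory GRing.Theory Num.Theory numFieldNormedType.Exports.
Local Open Scope classical_set_scope.
Local Open Scope ring_scope.

(* Here `| y t | is the library norm of matrices (mx_norm), i.e. the maximum
   absolute entry; the supremum over t may be +oo. *)
Definition linf_norm (R : realType) (m : nat) (y : nat -> 'cV[R]_m) : \bar R :=
  ereal_sup [set (`| y t |)%:E | t in [set: nat]].

(* (w, y) is an input-output pair of the Lur'e system with initial state x0. *)
Definition lure_io (R : realType) (n d e q p : nat)
    (A : 'M[R]_n) (B1 : 'M[R]_(n, d)) (B2 : 'M[R]_(n, e))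
    (C1 : 'M[R]_(q, n)) (F1 : 'M[R]_(q, e))
    (C2 : 'M[R]_(p, n)) (F2 : 'M[R]_(p, e))
    (f : nat -> 'cV[R]_q -> 'cV[R]_d)
    (x0 : 'cV[R]_n) (w : nat -> 'cV[R]_e) (y : nat -> 'cV[R]_p) : Prop :=
  exists (x : nat -> 'cV[R]_n) (z : nat -> 'cV[R]_d),
    x 0%N = x0 /\
    forall t : nat,
      [/\ x t.+1 = A *m x t + B1 *m z t + B2 *m w t,
          z t = f t (C1 *m x t + F1 *m w t)
        & y t = C2 *m x t + F2 *m w t].

(* The gain of a system given by its input-output relation io, where io x0 w y
   says that input w can produce output y from the initial state x0.  It takes
   values in the extended reals: a ratio is +oo when the output difference is
   unbounded, and the supremum is -oo if there is no admissible pair, which for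
   a Lur'e system happens only when the input dimension is 0. *)
Definition incremental_linf_gain (R : realType) (n e p : nat)
    (io : 'cV[R]_n -> (nat -> 'cV[R]_e) -> (nat -> 'cV[R]_p) -> Prop) :
    \bar R :=
  ereal_sup [set r : \bar R |
    exists (x0 : 'cV[R]_n) (w1 w2 : nat -> 'cV[R]_e) (y1 y2 : nat -> 'cV[R]_p),
      [/\ io x0 w1 y1,
          io x0 w2 y2,
          (0 < linf_norm (fun t => w1 t - w2 t)%R < +oo)%E
        & r = (linf_norm (fun t => y1 t - y2 t)%R /
               linf_norm (fun t => w1 t - w2 t)%R)%E]].

(* The elementwise supremum over t is taken in the extended reals, so that the
   inequality also asserts that it is finite. *)
Definition incremental_bound (R : realType) (d q : nat)
    (f : nat -> 'cV[R]_q -> 'cV[R]_d) (Delta : 'M[R]_(d, q)) : Prop :=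
  forall (zeta1 zeta2 : 'cV[R]_q) (i : 'I_d),
    (ereal_sup [set (`| (f t zeta1 - f t zeta2) i ord0 |)%:E
                 | t in [set: nat]]
     <= ((Delta *m map_mx Num.norm (zeta1 - zeta2)) i ord0)%:E)%E.

(* Main.v *)
Require Import Defs.
From mathcomp Require Import all_boot all_order all_algebra.
From mathcomp Require Import all_classical all_reals all_analysis.
Set Implicit Arguments.
Unset Strict Implicit.
Unset Printing Implicit Defensive.
Import Order.TTheory GRing.Theory Num.Theory numFieldNormedType.Exports.
Local Open Scope classical_set_scope.
Local Open Scope ring_scope.

(** The idea is that [v] spans an invariant box for the incremental system.
Let two trajectories start at the same point and write [dx], [dz], [dw], [dy]
for the differences of their signals, and [g] for the norm of [dw], so that
[|dw t|] is at most [g] in every entry.  If [|dx t| <= g v] entrywise, then,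
all matrices being nonnegative and [f] having incremental bound [Delta],
<<
  |dx t.+1| <= A |dx t| + B1 Delta (C1 |dx t| + F1 |dw t|) + B2 |dw t|
            <= g (A_Delta v + B_Delta 1) <= g v.
>>
As [dx 0 = 0 <= g v], induction on [t] ([lure_state_dominated]) keeps [dx] in
the box for ever, whence [|dy t| <= g (C2 v + F2 1) <= g eta] entrywise.
The ratio of the norms is thus at most [eta].

The calculus behind these chains is the relation [dominated u b], meaning
[|u| <= b] entrywise: it is preserved by sums, by nonnegative matrices and,
through [Delta], by increments of [f]. *)

Section Domination.
Variable R : realType.

Definition dominated (m : nat) (u b : 'cV[R]_m) : Prop :=
  forall i, `|u i ord0| <= b i ord0.

Lemma dominated0 m (b : 'cV[R]_m) : b \is a mxOver Num.nneg -> dominated 0 b.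
Proof. by move=> /mxOverP b_ge0 i; rewrite mxE normr0 -nnegrE. Qed.

Lemma dominatedD m (u1 u2 b1 b2 : 'cV[R]_m) :
  dominated u1 b1 -> dominated u2 b2 -> dominated (u1 + u2) (b1 + b2).
Proof.
move=> h1 h2 i; rewrite !mxE; apply: le_trans (ler_normD _ _) _.
exact: lerD.
Qed.

Lemma dominated_le m (u b c : 'cV[R]_m) :
  c - b \is a mxOver Num.nneg -> dominated u b -> dominated u c.
Proof.
move=> /mxOverP le_bc ub i; apply: le_trans (ub i) _.
by have := le_bc i ord0; rewrite !mxE nnegrE subr_ge0.
Qed.

(** This is where nonnegativity of the system matrices is used: the triangle
inequality gives [|M u| <= |M| |u|], and [|M| = M]. *)
Lemma dominated_mulmx m k (M : 'M[R]_(m, k)) (u b : 'cV[R]_k) :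
  M \is a mxOver Num.nneg -> dominated u b -> dominated (M *m u) (M *m b).
Proof.
move=> /mxOverP M_ge0 ub i; rewrite !mxE.
apply: le_trans (ler_norm_sum _ _ _) _; apply: ler_sum => j _.
have Mij : 0 <= M i j by rewrite -nnegrE.
by rewrite normrM (ger0_norm Mij) ler_wpM2l.
Qed.

Lemma dominated_norm m (u : 'cV[R]_m) : dominated u (const_mx `|u|).
Proof.
move=> i; rewrite [leRHS]mxE [leRHS]mx_normrE.
exact: (le_bigmax _ (fun ij => `|u ij.1 ij.2|) (i, ord0)).
Qed.

(** An entry is needed to see that the bound is nonnegative: in dimension 0
every constant dominates the empty vector. *)
Lemma norm_le_dominated m (u : 'cV[R]_m) (c : R) :
  (0 < m)%N -> dominated u (const_mx c) -> `|u| <= c.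
Proof.
move=> m_gt0 uc.
have le_uc i : `|u i ord0| <= c by have := uc i; rewrite [leRHS]mxE.
rewrite [leLHS]mx_normrE; apply/bigmax_leP; split=> [|[i j] _] /=.
  exact: le_trans (normr_ge0 _) (le_uc (Ordinal m_gt0)).
by rewrite (ord1 j).
Qed.

Lemma dominated_incremental_bound d q (f : nat -> 'cV[R]_q -> 'cV[R]_d)
    (Delta : 'M[R]_(d, q)) t (z1 z2 b : 'cV[R]_q) :
  Delta \is a mxOver Num.nneg -> incremental_bound f Delta ->
  dominated (z1 - z2) b -> dominated (f t z1 - f t z2) (Delta *m b).
Proof.
move=> Delta_ge0 f_bound zb i.
have le_f : `|(f t z1 - f t z2) i ord0|
            <= (Delta *m map_mx Num.norm (z1 - z2)) i ord0.
  rewrite -lee_fin; apply: le_trans (f_bound z1 z2 i).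
  by apply: ereal_sup_ubound; exists t.
apply: le_trans le_f _; apply: le_trans (ler_norm _) _.
apply: dominated_mulmx => // j; rewrite mxE normr_id; exact: zb.
Qed.

Lemma linf_norm_ge m (y : nat -> 'cV[R]_m) t : (`|y t|%:E <= linf_norm y)%E.
Proof. by apply: ereal_sup_ubound; exists t. Qed.

Lemma linf_norm_le_dominated m (y : nat -> 'cV[R]_m) (c : R) :
  (0 < m)%N -> (forall t, dominated (y t) (const_mx c)) ->
  (linf_norm y <= c%:E)%E.
Proof.
move=> m_gt0 yc; apply: ge_ereal_sup => _ [t _ <-].
by rewrite lee_fin; apply: norm_le_dominated.
Qed.

End Domination.

(** The inequality on [v] says that the monotone comparison system
[X |-> A_Delta X + B_Delta b] maps [v] below itself, so that a difference of
states which starts below [v], namely at [0], cannot leave the box.  The bound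
[b] stays a vector because the argument is positively homogeneous: the input
norm enters only by scaling [v] and [b] together. *)
Lemma lure_state_dominated (R : realType) (n d e q : nat)
    (A : 'M[R]_n) (B1 : 'M[R]_(n, d)) (B2 : 'M[R]_(n, e))
    (C1 : 'M[R]_(q, n)) (F1 : 'M[R]_(q, e))
    (f : nat -> 'cV[R]_q -> 'cV[R]_d) (Delta : 'M[R]_(d, q))
    (w1 w2 : nat -> 'cV[R]_e) (x1 x2 : nat -> 'cV[R]_n)
    (v : 'cV[R]_n) (b : 'cV[R]_e) :
  Delta \is a mxOver Num.nneg -> incremental_bound f Delta ->
  A \is a mxOver Num.nneg ->
  B1 \is a mxOver Num.nneg -> B2 \is a mxOver Num.nneg ->
  C1 \is a mxOver Num.nneg -> F1 \is a mxOver Num.nneg ->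
  (forall t, x1 t.+1
     = A *m x1 t + B1 *m f t (C1 *m x1 t + F1 *m w1 t) + B2 *m w1 t) ->
  (forall t, x2 t.+1
     = A *m x2 t + B1 *m f t (C1 *m x2 t + F1 *m w2 t) + B2 *m w2 t) ->
  x1 0%N = x2 0%N ->
  (forall t, dominated (w1 t - w2 t) b) ->
  v \is a mxOver Num.nneg ->
  v - (A + B1 *m Delta *m C1) *m v - (B2 + B1 *m Delta *m F1) *m b
    \is a mxOver Num.nneg ->
  forall t, dominated (x1 t - x2 t) v.
Proof.
move=> Delta_ge0 f_bound A_ge0 B1_ge0 B2_ge0 C1_ge0 F1_ge0.
move=> x1S x2S x0E wb v_ge0 v_inv.
elim=> [|t IHt]; first by rewrite x0E subrr; apply: dominated0.
rewrite x1S x2S.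
set z1 := C1 *m x1 t + F1 *m w1 t; set z2 := C1 *m x2 t + F1 *m w2 t.
have zb : dominated (z1 - z2) (C1 *m v + F1 *m b).
  rewrite /z1 /z2 opprD addrACA -!mulmxBr.
  by apply: dominatedD; apply: dominated_mulmx.
rewrite opprD addrACA opprD [X in X + _]addrACA -!mulmxBr.
apply: (@dominated_le _ _ _
  (A *m v + B1 *m (Delta *m (C1 *m v + F1 *m b)) + B2 *m b)); last first.
  apply: dominatedD; last exact: dominated_mulmx.
  apply: dominatedD; first exact: dominated_mulmx.
  exact/dominated_mulmx/dominated_incremental_bound.
have -> : v - (A *m v + B1 *m (Delta *m (C1 *m v + F1 *m b)) + B2 *m b)
        = v - (A + B1 *m Delta *m C1) *m v - (B2 + B1 *m Delta *m F1) *m b.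
  rewrite !mulmxDl !mulmxDr !mulmxA -[RHS]addrA -opprD; congr (v - _).
  by rewrite -!addrA; congr (_ + (_ + _)); rewrite addrC.
exact: v_inv.
Qed.

Theorem theorem2 (R : realType) (n d e q p : nat) (hp : (0 < p)%N)
    (A : 'M[R]_n) (B1 : 'M[R]_(n, d)) (B2 : 'M[R]_(n, e))
    (C1 : 'M[R]_(q, n)) (F1 : 'M[R]_(q, e))
    (C2 : 'M[R]_(p, n)) (F2 : 'M[R]_(p, e))
    (f : nat -> 'cV[R]_q -> 'cV[R]_d)
    (Delta : 'M[R]_(d, q))
    (hDelta : Delta \is a mxOver Num.nneg)
    (hA1 : incremental_bound f Delta)
    (hB1 : B1 \is a mxOver Num.nneg) (hB2 : B2 \is a mxOver Num.nneg)
    (hF1 : F1 \is a mxOver Num.nneg) (hF2 : F2 \is a mxOver Num.nneg)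
    (hA : A \is a mxOver Num.nneg)
    (hC1 : C1 \is a mxOver Num.nneg) (hC2 : C2 \is a mxOver Num.nneg)
    (eta : R) :
  let ADelta := A + B1 *m Delta *m C1 in
  let BDelta := B2 + B1 *m Delta *m F1 in
  (exists v : 'cV[R]_n,
    [/\ v \is a mxOver Num.pos,
        v - ADelta *m v - BDelta *m (const_mx 1 : 'cV[R]_e)
          \is a mxOver Num.pos
      & (const_mx eta : 'cV[R]_p) - F2 *m (const_mx 1 : 'cV[R]_e) - C2 *m v
          \is a mxOver Num.pos]) ->
  (incremental_linf_gain (lure_io A B1 B2 C1 F1 C2 F2 f) <= eta%:E)%E.
Proof.
move=> ADelta BDelta [v [v_gt0 v_inv v_out]].
have posW m (b : 'cV[R]_m) : b \is a mxOver Num.pos -> b \is a mxOver Num.nneg.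
  by move=> /mxOverP b_gt0; apply/mxOverP => i j; rewrite nnegrE ltW // -posrE.
apply: ge_ereal_sup => _ [x0 [w1 [w2 [y1 [y2 [io1 io2 /andP[g_gt0 g_fin] ->]]]]]].
case: io1 => x1 [z1 [x10 io1]]; case: io2 => x2 [z2 [x20 io2]].
case gE: (linf_norm _) g_gt0 g_fin => [g| |] //; rewrite lte_fin => g_gt0 _.
have g_nneg : g \in Num.nneg by rewrite nnegrE ltW.
have wb t : dominated (w1 t - w2 t) (g *: const_mx 1).
  apply: dominated_le (dominated_norm _).
  apply/mxOverP => i j; rewrite !mxE mulr1 nnegrE subr_ge0 -lee_fin -gE.
  exact: (linf_norm_ge (fun t => w1 t - w2 t)).
have xb : forall t, dominated (x1 t - x2 t) (g *: v).
  apply: (lure_state_dominated hDelta hA1 hA hB1 hB2 hC1 hF1 _ _ _ wb).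
  - by move=> t; have [-> <- _] := io1 t.
  - by move=> t; have [-> <- _] := io2 t.
  - by rewrite x10 x20.
  - by apply: mxOverZ => //; apply: posW.
  - by rewrite -!scalemxAr -!scalerBr; apply: mxOverZ => //; apply: posW.
have yb : forall t, dominated (y1 t - y2 t) (const_mx (eta * g)).
  move=> t; have [_ _ ->] := io1 t; have [_ _ ->] := io2 t.
  rewrite opprD addrACA -!mulmxBr.
  apply: (@dominated_le _ _ _ (C2 *m (g *: v) + F2 *m (g *: const_mx 1))).
    have -> : const_mx (eta * g) = g *: const_mx eta :> 'cV[R]_p.
      by apply/matrixP => i j; rewrite !mxE mulrC.
    rewrite -!scalemxAr -scalerDr -scalerBr [C2 *m v + _]addrC opprD addrA.
    by apply: mxOverZ => //; apply: posW.
  by apply: dominatedD; apply: dominated_mulmx.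
rewrite inver gt_eqF // lee_pdivrMr // -EFinM.
exact: linf_norm_le_dominated.
Qed.
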